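(* Let $n\ge2$, $r\ge1$, $d\ge2$ be integers, $e=\gcd(r,d)$ and $\mu=d/e$. Let $\Gamma$ be a form of order $d$ in $n$ variables $x_1,\dots,x_n$ over $\mathbf C$. Then $\widetilde{\mathfrak G}_{r,d}(\Gamma)$ is identically zero if and only if $\Gamma=G^\mu$ for some form $G$ of order $e$ in $x_1,\dots,x_n$.
   Context: The base field is $\mathbf C$; ''order'' means homogeneous degree. Binary covariant $\mathfrak G_{r,d}$: for binary forms $A$ of order $r$ and $F$ of order $d$ in variables $\lambda_1,\lambda_2$ put $(A,F)_1=\frac1{rd}\left(\frac{\partial A}{\partial \lambda_1}\frac{\partial F}{\partial \lambda_2}-\frac{\partial A}{\partial \lambda_2}\frac{\partial F}{\partial \lambda_1}\right)$. Let $C_i=(\lambda_1^{r-i}\lambda_2^i,F)_1$ for $0\le i\le r$. Then $\mathfrak G_{r,d}(F)$ is the determinant of the $(r+1)\times(r+1)$ matrix with $(i,j)$ entry $\frac{\partial^r C_i}{\partial\lambda_1^{r-j}\partial\lambda_2^j}$, $0\le i,j\le r$. Clebsch transfer $\widetilde{\mathfrak G}_{r,d}$: let $p=(p_1,\dots,p_n)$ and $q=(q_1,\dots,q_n)$ be tuples of indeterminates (two points spanning a generic line in $\mathbf P^{n-1}$). Substitute $x_i=\lambda_1p_i+\lambda_2q_i$ ($1\le i\le n$) into $\Gamma$, regard the result as a binary form of order $d$ in $\lambda_1,\lambda_2$ (with coefficients in $\mathbf C[p,q]$), and evaluate $\mathfrak G_{r,d}$ on it. The resulting polynomial in $\lambda_1,\lambda_2,p_1,\dots,p_n,q_1,\dots,q_n$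 is $\widetilde{\mathfrak G}_{r,d}(\Gamma)$. (It can be rewritten in terms of the variables $x_i=\lambda_1p_i+\lambda_2q_i$ and the Plücker coordinates $p_iq_j-p_jq_i$ of the line; ''identically zero'' means zero as a polynomial.) *)

(* Defs.v *)
From HB Require Import structures.
From mathcomp Require Import all_boot all_order all_algebra.
From mathcomp Require Import mpoly complex reals.

Set Implicit Arguments.
Unset Strict Implicit.
Unset Printing Implicit Defensive.

Import GRing.Theory.
Local Open Scope ring_scope.

(* Binary forms are elements of {mpoly K[2]}, where K is a commutative algebra
   over the base field k; K itself may be a polynomial ring such as k[p, q]. *)

Definition i1 : 'I_2 := ord0.
Definition i2 : 'I_2 := ord_max.

(* (A, F)_1.  The orders r of A and d of F are explicit arguments, since they
   cannot be read off when a form vanishes. *)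
Definition transvectant1 (k : fieldType) (K : comAlgType k) (r d : nat)
    (A F : {mpoly K[2]}) : {mpoly K[2]} :=
  (((r * d)%N%:R^-1 : k)%:A : K) *:
    (A^`M(i1) * F^`M(i2) - A^`M(i2) * F^`M(i1)).

Definition C_form (k : fieldType) (K : comAlgType k) (r d : nat)
    (F : {mpoly K[2]}) (i : nat) : {mpoly K[2]} :=
  transvectant1 r d ('X_i1 ^+ (r - i) * 'X_i2 ^+ i) F.

Definition frakG (k : fieldType) (K : comAlgType k) (r d : nat)
    (F : {mpoly K[2]}) : {mpoly K[2]} :=
  \det (\matrix_(i < r.+1, j < r.+1)
          (C_form r d F i)^`M[U_(i1) *+ (r - j) + U_(i2) *+ j]).

(* In {mpoly k[n + n]} the first n variables are p_1, .., p_n and the last n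
   are q_1, .., q_n; restrict_line Gamma is Gamma (lambda_1 p + lambda_2 q). *)
Definition restrict_line (k : fieldType) (n : nat) (Gamma : {mpoly k[n]}) :
    {mpoly {mpoly k[n + n]}[2]} :=
  mmap (fun c : k => (c%:MP : {mpoly k[n + n]})%:MP)
       (fun i : 'I_n => 'X_i1 * ('X_(lshift n i) : {mpoly k[n + n]})%:MP
                      + 'X_i2 * ('X_(rshift n i) : {mpoly k[n + n]})%:MP)
       Gamma.

Definition clebsch_transfer (k : fieldType) (n r d : nat)
    (Gamma : {mpoly k[n]}) : {mpoly {mpoly k[n + n]}[2]} :=
  frakG r d (restrict_line Gamma).

(* Main.v *)
(* A kernel vector of the matrix defining [frakG r d F] shows that [frakG r d F]
   vanishes exactly when some nonzero form [A] of order [r], with constant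
   coefficients, satisfies [(A, F)_1 = 0], as for Wronskians.  In the affine
   coordinate this reads [d a' f = r a f'], so [a ^ d / f ^ r] is constant, and
   unique factorization turns [f] into a constant times a [d / gcd(r, d)]-th
   power.  Conversely, if [F = g ^ mu] then [A = g ^ (r / gcd(r, d))] works.

   To descend from lines to [Gamma], fix a point [v] with [Gamma(v) <> 0] and
   restrict [Gamma] to the lines [t v + x] through [v], with [x] generic: this
   is a polynomial in [t] with constant leading coefficient [Gamma(v)] and
   constant term [Gamma].  Its monic root a priori has coefficients in the
   fraction field of [C[x]], but they are computed recursively from those of
   its power, so they lie in [C[x]]; setting [t = 0] gives a root of [Gamma]. *)

Require Import Defs.
From HB Require Import structures.
From mathcomp Require Import all_boot all_order all_algebra.
From mathcomp Require Import ring mpoly complex reals.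

Set Implicit Arguments.
Unset Strict Implicit.
Unset Printing Implicit Defensive.

Import GRing.Theory.
Local Open Scope ring_scope.

(** * Generalized Wronskians *)

(** In the affine coordinate a mixed partial derivative of a form becomes, up to a power of ['X], an
    operator of this kind. *)
Definition diag_op (R : nzRingType) (w : nat -> R) (y : {poly R}) : {poly R} :=
  \poly_(n < size y) (w n * y`_n).

Lemma coef_diag_op (R : nzRingType) (w : nat -> R) (y : {poly R}) n :
  (diag_op w y)`_n = w n * y`_n.
Proof.
rewrite coef_poly; case: ltnP => // le_yn.
by rewrite (nth_default 0 le_yn) mulr0.
Qed.

Lemma diag_op_sum (R : comNzRingType) (w : nat -> R) (I : Type) (s : seq I)
    (x : I -> R) (c : I -> {poly R}) :
  diag_op w (\sum_(i <- s) x i *: c i) = \sum_(i <- s) x i *: diag_op w (c i).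
Proof.
apply/polyP => n; rewrite coef_diag_op !coef_sum mulr_sumr.
by apply: eq_bigr => i _; rewrite !coefZ coef_diag_op mulrCA.
Qed.

Lemma mulrn_inj_char0 (R : idomainType) (c : R) :
  [pchar R] =i pred0 -> c != 0 -> injective (fun n => c *+ n).
Proof.
move=> /pcharf0P char0 c_neq0 m n /eqP.
wlog le_mn : m n / (m <= n)%N => [th|].
  by case/orP: (leq_total m n) => /th // {}th; rewrite eq_sym => /th.
rewrite eq_sym -subr_eq0 -mulrnBr // -mulr_natl mulf_eq0 (negPf c_neq0) orbF.
by rewrite char0 subn_eq0 => le_nm; apply/eqP; rewrite eqn_leq le_mn.
Qed.

Lemma coef_mul_top (R : nzSemiRingType) (p q : {poly R}) m n :
    (size p <= m.+1)%N -> (size q <= n.+1)%N ->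
  (p * q)`_(m + n) = p`_m * q`_n.
Proof.
move=> sp sq; rewrite coefM.
have ltm : (m < (m + n).+1)%N by rewrite ltnS leq_addr.
rewrite (bigD1 (Ordinal ltm)) //= addKn big1 ?addr0 // => -[i lti] /=.
rewrite -val_eqE /= => neq_im.
case: (ltngtP i m) neq_im => // [lt_im|lt_mi] _.
  rewrite (nth_default 0 (s := q)) ?mulr0 // (leq_trans sq) //.
  by rewrite -ltnS in lti *; rewrite ltn_subRL; rewrite ltn_add2r.
by rewrite (nth_default 0 (s := p)) ?mul0r // (leq_trans sp).
Qed.

(* A column kernel vector [u] is a differential equation satisfied by all [c i];
   its top coefficients form an equation for the degrees of the solutions, which
   [few_roots] says has at most [r] roots.  Some combination of the [r + 1]
   polynomials [c i] has no term in these degrees, and so vanishes. *)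
Lemma diag_wronskian_dependent (L : fieldType) (r m : nat)
    (c : 'I_r.+1 -> {poly L}) (w : 'I_r.+1 -> nat -> L) :
    (forall i, (size (c i) <= m.+1)%N) ->
    (forall l : 'I_r.+1 -> L, (exists j, l j != 0) ->
       exists2 Z : seq nat, (size Z <= r)%N &
         forall n, (n <= m)%N -> \sum_j l j * w j n = 0 -> n \in Z) ->
    \det (\matrix_(i, j) diag_op (w j) (c i)) = 0 ->
  exists2 x : 'rV[L]_r.+1, x != 0 & \sum_i x 0 i *: c i = 0.
Proof.
move=> size_c few_roots /eqP; rewrite -det_tr => /det0P[u u_neq0 uM0].
have [j0 u_j0] : exists j, u 0 j != 0 by apply/rV0Pn.
(* The degree [k] is attained by some entry of [u], so the coefficients of degree [k] are not all
   zero and [few_roots] applies to them. *)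
pose k := (\max_j size (u 0%R j)).-1.
have size_u j : (size (u 0%R j) <= k.+1)%N.
  by rewrite (leq_trans _ (leqSpred _)) // (leq_bigmax j).
have [|Z size_Z rootZ] := few_roots (fun j => (u 0 j)`_k).
  have [j1 eq_j1] : {j1 | \max_j size (u 0%R j) = size (u 0%R j1)}.
    by apply: eq_bigmax; rewrite card_ord.
  exists j1; rewrite /k eq_j1 -lead_coefE lead_coef_eq0 -size_poly_gt0 -eq_j1.
  by rewrite (leq_trans _ (leq_bigmax j0)) // size_poly_gt0.
(* [A] has more rows than columns, so some nonzero combination of its rows vanishes; the same
   combination of the [c i] has no term in a degree of [Z]. *)
pose A := \matrix_(i < r.+1, z < size Z) (c i)`_(nth 0%N Z z).
have /matrix0Pn[i1 [j1 nz]]: kermx A != 0.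
  rewrite kermx_eq0 /row_free neq_ltn.
  by rewrite (leq_ltn_trans (rank_leq_col A)).
exists (row i1 (kermx A)).
  by apply/rV0Pn; exists j1; rewrite mxE.
set x := row i1 _; have xA0 : x *m A = 0.
  by rewrite -row_mul mulmx_ker row0.
move: x xA0 => x xA0 {i1 j1 nz}.
set y := \sum_i _.
have yZ n : n \in Z -> y`_n = 0.
  move=> nZ; have ltZ : (index n Z < size Z)%N by rewrite index_mem.
  have := congr1 (fun B : 'rV_ _ => B 0 (Ordinal ltZ)) xA0.
  rewrite !mxE => e0; rewrite -[RHS]e0 coef_sum; apply: eq_bigr => i _.
  by rewrite coefZ [A _ _]mxE /= nth_index.
have size_y : (size y <= m.+1)%N.
  apply: (leq_trans (size_sum _ _ _)); apply/bigmax_leqP => i _.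
  exact: leq_trans (size_scale_leq _ _) _.
have uy0 : \sum_j u 0 j * diag_op (w j) y = 0.
  under eq_bigr => j _ do rewrite diag_op_sum mulr_sumr.
  rewrite exchange_big big1 // => i _.
  have := congr1 (fun B : 'rV_ _ => x 0 i *: B 0 i) uM0.
  rewrite !mxE scaler0 => e0; rewrite -[RHS]e0 scaler_sumr; apply: eq_bigr => j _.
  by rewrite !mxE scalerAr.
(* If [y] were nonzero, the coefficient of [uy0] in degree [k] plus the degree of [y] would make the
   latter a root of the indicial equation, hence an element of [Z], where [y] has no term. *)
apply/eqP; apply/negPn/negP => y_neq0.
have y_top : y`_(size y).-1 != 0 by rewrite -lead_coefE lead_coef_eq0.
case/negP: (y_top); apply/eqP/yZ/rootZ.
  by rewrite -ltnS (leq_trans _ size_y) // ltn_predL size_poly_gt0.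
apply: (mulIf y_top); rewrite mul0r mulr_suml.
have := congr1 (fun p : {poly L} => p`_(k + (size y).-1)) uy0.
rewrite coef0 coef_sum => e0; rewrite -[RHS]e0; apply: eq_bigr => j _.
rewrite coef_mul_top ?coef_diag_op ?mulrA //.
exact: leq_trans (size_poly _ _) (leqSpred _).
Qed.

Lemma natr_ffact (R : comNzRingType) (n k : nat) :
  (n ^_ k)%:R = \prod_(i < k) (n%:R - i%:R) :> R.
Proof.
elim: k => [|k IHk]; first by rewrite big_ord0.
rewrite big_ord_recr -IHk /= ffactnSr natrM.
have [le_kn|lt_nk] := leqP k n; first by rewrite natrB.
by rewrite ffact_small // !mul0r.
Qed.

Lemma size_prod_linear_leq (R : idomainType) (k : nat) (F : 'I_k -> {poly R}) :
  (forall i, size (F i) <= 2)%N -> (size (\prod_i F i)%R <= k.+1)%N.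
Proof.
elim: k F => [|k IHk] F size_F; first by rewrite big_ord0 size_poly1.
rewrite big_ord_recr; apply: (leq_trans (size_polyMleq _ _)).
have := leq_add (IHk _ (fun i => size_F (widen_ord (leqnSn k) i)))
                (size_F ord_max).
by rewrite addn2; case: (_ + _)%N.
Qed.

(* For [n <= m], [indicial_weight m r j n] is the coefficient of
   [d1^(r-j) d2^j] applied to [lambda1^n lambda2^(m-n)]. *)
Definition indicial_weight (m r j n : nat) : nat :=
  (n ^_ (r - j) * (m - n) ^_ j)%N.

(** With falling factorials read as polynomials in [n], the sum is the value at [n] of a polynomial
    [chi] of degree at most [r]. Characteristic zero keeps distinct [n] distinct in [L]. *)
Lemma indicial_few_roots (L : fieldType) (r m : nat) (l : 'I_r.+1 -> L) :
    [pchar L] =i pred0 -> (r <= m)%N -> (exists j, l j != 0) ->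
  exists2 Z : seq nat, (size Z <= r)%N &
    forall n, (n <= m)%N ->
      \sum_j l j * (indicial_weight m r j n)%:R = 0 -> n \in Z.
Proof.
move=> char0 le_rm [j0 nz_j0]; have /pcharf0P natr_eq0 := char0.
pose P (j : 'I_r.+1) : {poly L} :=
  (\prod_(i < r - j) ('X - i%:R%:P)) * \prod_(i < j) (m%:R%:P - 'X - i%:R%:P).
pose chi := \sum_j l j *: P j.
have chiE n : (n <= m)%N ->
    chi.[n%:R] = \sum_j l j * (indicial_weight m r j n)%:R.
  move=> le_nm; rewrite horner_sum; apply: eq_bigr => j _.
  rewrite hornerZ hornerM !horner_prod natrM !natr_ffact natrB //.
  by congr (_ * (_ * _)); apply: eq_bigr => i _; rewrite !hornerE.
have size_chi : (size chi <= r.+1)%N.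
  apply: (leq_trans (size_sum _ _ _)); apply/bigmax_leqP => j _.
  apply: (leq_trans (size_scale_leq _ _)).
  apply: (leq_trans (size_polyMleq _ _)).
  have h1 : (size (\prod_(i < r - j) ('X - i%:R%:P : {poly L}))%R <= (r - j).+1)%N.
    by apply: size_prod_linear_leq => i; rewrite size_XsubC.
  have h2 : (size (\prod_(i < j) (m%:R%:P - 'X - i%:R%:P : {poly L}))%R <= j.+1)%N.
    apply: size_prod_linear_leq => i; rewrite addrAC -polyCB -opprB size_polyN.
    by rewrite size_XsubC.
  have := leq_add h1 h2; rewrite addSn addnS subnK -1?ltnS //.
  by case: (_ + _)%N.
have chi_neq0 : chi != 0.
  (* Evaluate [chi] at [r - j1], with [j1] the largest index of a nonzero [l j]: the terms below
     [j1] contain a vanishing falling factorial, and the term at [j1] survives because [r <= m]. *)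
  have [j1 nz_j1 max_j1] : exists2 j1 : 'I_r.+1, l j1 != 0 &
      forall j : 'I_r.+1, (j1 < j)%N -> l j = 0.
    exists [arg max_(j > j0 | l j != 0) (j : nat)]; case: arg_maxnP => // j1 nz max_j1.
    move=> j; rewrite ltnNge; apply: contraNeq; exact: max_j1.
  have le_j1r : (j1 <= r)%N by rewrite -ltnS.
  apply/eqP => chi0; have := chiE (r - j1)%N (leq_trans (leq_subr _ _) le_rm).
  rewrite chi0 horner0 (bigD1 j1) //= big1 ?addr0 => [|j neq_j].
    move/esym/eqP; rewrite mulf_eq0 (negPf nz_j1) /= natr_eq0 muln_eq0.
    rewrite !eqn0Ngt !ffact_gt0 leqnn /= leq_subRL ?(leq_trans (leq_subr _ _)) //.
    by rewrite subnK // le_rm.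
  case: (ltngtP j j1) neq_j => [lt_j|lt_j|/val_inj->]; last by rewrite eqxx.
    rewrite /indicial_weight ffact_small ?mul0n ?mulr0 //.
    by rewrite ltn_sub2l // (leq_trans lt_j).
  by rewrite max_j1 // mul0r.
exists [seq n <- iota 0 m.+1 | root chi n%:R].
  pose Z := [seq n <- iota 0 m.+1 | root chi n%:R].
  have /= lt_Z := @max_poly_roots _ chi [seq n%:R : L | n <- Z] chi_neq0.
  rewrite -ltnS -(size_map (fun n => n%:R : L)).
  apply: leq_trans (lt_Z _ _) size_chi.
    by apply/allP => _ /mapP[n + ->]; rewrite mem_filter => /andP[].
  rewrite map_inj_uniq ?filter_uniq ?iota_uniq //.
  exact: mulrn_inj_char0 char0 (oner_neq0 L).
move=> n le_nm; rewrite -chiE // => /eqP chi_n.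
by rewrite mem_filter mem_iota /root chi_n.
Qed.

(** * Roots of polynomials *)

(* Multiplication by ['X] makes the derivation degree preserving. *)
Lemma coefX_deriv (R : nzRingType) (p : {poly R}) n :
  ('X * p^`())`_n = p`_n *+ n.
Proof. by rewrite coefXM coef_deriv; case: n => [|n] //=; rewrite mulr0n. Qed.

Lemma size_X_deriv_leq (R : nzRingType) (p : {poly R}) :
  (size ('X * p^`())%R <= size p)%N.
Proof.
by apply/leq_sizeP => n le_n; rewrite coefX_deriv nth_default ?mul0rn.
Qed.

(* Compare the leading terms of the two sides, both multiplied by ['X]. *)
Lemma size_deriv_proportional (R : idomainType) (p q : {poly R}) (k l : nat) :
    [pchar R] =i pred0 -> p != 0 -> q != 0 ->
    p^`() * q *+ k = p * q^`() *+ l ->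
  ((size p).-1 * k = (size q).-1 * l)%N.
Proof.
move=> char0 p_neq0 q_neq0 eqpq.
have {}eqpq : 'X * p^`() * q *+ k = p * ('X * q^`()) *+ l.
  by rewrite -mulrA -mulrnAr eqpq mulrnAr mulrCA.
have := congr1 (fun s : {poly R} => s`_((size p).-1 + (size q).-1)) eqpq.
rewrite !coefMn !coef_mul_top ?leqSpred //.
all: try exact: leq_trans (size_X_deriv_leq _) (leqSpred _).
rewrite !coefX_deriv.
rewrite -!lead_coefE mulrnAl mulrnAr -!mulrnA.
have lc_neq0 : lead_coef p * lead_coef q != 0.
  by rewrite mulf_neq0 ?lead_coef_eq0.
exact: (mulrn_inj_char0 char0 lc_neq0).
Qed.

(** The difference of [p] and [q] satisfies the same equation with [q], so if nonzero it would have
    the degree of [q], although the leading terms cancel. *)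
Lemma monic_eq_deriv (R : idomainType) (p q : {poly R}) :
    [pchar R] =i pred0 -> p \is monic -> q \is monic -> size p = size q ->
    p^`() * q = p * q^`() ->
  p = q.
Proof.
move=> char0 mon_p mon_q eq_size eqpq; apply/eqP; rewrite -subr_eq0.
apply/negPn/negP => d_neq0; set d := p - q in d_neq0.
have lt_dq : (size d < size q)%N.
  have le_dq : (size d <= size q)%N.
    by rewrite (leq_trans (size_polyD _ _)) // size_polyN eq_size maxnn.
  rewrite ltn_neqAle le_dq andbT; apply: contraNneq d_neq0 => eq_d.
  rewrite -lead_coef_eq0 lead_coefE eq_d coefB -lead_coefE -eq_size.
  by rewrite -lead_coefE !(monicP _) ?subrr.
have q_neq0 := monic_neq0 mon_q.
have: d^`() * q *+ 1 = d * q^`() *+ 1.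
  by rewrite !mulr1n derivB !mulrBl eqpq [q^`() * q]mulrC.
move/(size_deriv_proportional char0 d_neq0 q_neq0); rewrite !muln1 => eq_pred.
move: lt_dq; rewrite -[size d]prednK ?size_poly_gt0 // eq_pred.
by rewrite prednK ?size_poly_gt0 // ltnn.
Qed.

(* The equation says that [a ^+ k / f ^+ l] is constant; as [k] and [l] are
   coprime, [f] is then a [k]-th power in the factorial ring [{poly L}]. *)
Lemma root_of_deriv_proportional (L : fieldType) (a f : {poly L})
    (k l e : nat) :
    [pchar L] =i pred0 -> coprime k l -> (0 < k)%N ->
    a != 0 -> f \is monic -> size f = (e * k).+1 ->
    a^`() * f *+ k = a * f^`() *+ l ->
  exists h, [/\ h \is monic, size h = e.+1 & h ^+ k = f].
Proof.
move=> char0 co_kl k_gt0 a_neq0 mon_f size_f.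
wlog mon_a : a a_neq0 / a \is monic => [th eqaf|eqaf].
  have lc_neq0 : (lead_coef a)^-1 != 0 by rewrite invr_eq0 lead_coef_eq0.
  apply: (th ((lead_coef a)^-1 *: a)).
  - by rewrite scaler_eq0 negb_or lc_neq0.
  - by rewrite monicE lead_coefZ mulVf // lead_coef_eq0.
  - by rewrite derivZ -!scalerAl !scalerMnr eqaf.
have f_neq0 := monic_neq0 mon_f.
have size_a : ((size a).-1 * k = (e * k) * l)%N.
  by rewrite (size_deriv_proportional char0 a_neq0 f_neq0 eqaf) size_f.
(* Both powers are monic of the same degree and have the same logarithmic derivative. *)
have eq_pow : a ^+ k = f ^+ l.
  apply: monic_eq_deriv; rewrite ?monic_exp //.
    rewrite -[LHS]prednK ?size_poly_gt0 ?expf_neq0 //.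
    rewrite -[RHS]prednK ?size_poly_gt0 ?expf_neq0 //.
    by rewrite !size_exp size_a size_f.
  rewrite !deriv_exp; case: l eqaf {co_kl size_a} => [|l] eqaf.
    rewrite !mulr0n mulr0 expr0 mulr1.
    apply: (mulIf f_neq0); rewrite mul0r mulrnAl mulrAC -mulrnAl eqaf.
    by rewrite mulr0n mul0r.
  rewrite -(prednK k_gt0) /= in eqaf *.
  transitivity (a ^+ k.-1 * f ^+ l * (a^`() * f *+ k.-1.+1)).
    by rewrite exprS; ring.
  by rewrite eqaf exprS; ring.
(* Bezout gives [x * k = y * l + 1], so the quotient of [f ^+ x] by [a ^+ y] is a [k]-th root of
   [f]; comparing [k]-th powers shows that it is a polynomial. *)
case: (egcdnP l k_gt0) => x y; rewrite (eqP co_kl) => eq_xy _.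
have dvd_ay : a ^+ y %| f ^+ x.
  rewrite -(dvdp_pexp2r _ _ k_gt0) -!exprM eq_xy mulnC exprM eq_pow -exprM.
  by rewrite addn1 mulnC exprS dvdp_mull.
pose h := f ^+ x %/ a ^+ y.
have def_h : f ^+ x = h * a ^+ y by rewrite divpK.
have mon_h : h \is monic by rewrite -(monicMr h (monic_exp y mon_a)) -def_h monic_exp.
have h_k : h ^+ k = f.
  apply: (mulIf (expf_neq0 (y * k) a_neq0)); rewrite [in LHS]exprM -exprMn -def_h.
  by rewrite -exprM eq_xy addn1 exprS [(y * k)%N]mulnC [in RHS]exprM eq_pow -exprM mulnC.
exists h; split=> //.
have := size_exp h k; rewrite h_k size_f /= => /esym/eqP.
rewrite eqn_pmul2r // => /eqP <-.
by rewrite prednK // size_poly_gt0 monic_neq0.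
Qed.

(* The coefficients of [h] are determined from the top by those of [h ^+ k],
   using only division by [k]. *)
Lemma monic_root_descent (S : comNzRingType) (L : idomainType)
    (iota : {rmorphism S -> L}) (h : {poly L}) (f : {poly S}) (k e : nat)
    (u : S) :
    u * k.+1%:R = 1 -> h \is monic -> size h = e.+1 ->
    h ^+ k.+1 = map_poly iota f ->
  exists g, h = map_poly iota g.
Proof.
move=> uk1 mon_h size_h h_k.
(* After [j] steps [g] agrees with [h] in all degrees from [e - j] on; the start ['X^e] is correct
   because [h] is monic. *)
suff IH j : (j <= e)%N -> exists g, (size (h - map_poly iota g)%R <= e - j)%N.
  have [g] := IH e (leqnn e); rewrite subnn leqn0 size_poly_eq0 subr_eq0.
  by move=> /eqP ->; exists g.
elim: j => [_|j IHj lt_je].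
  exists 'X^e; rewrite subn0 map_polyXn; apply/leq_sizeP => i le_ei.
  rewrite coefB coefXn; have [->|neq_ie] := eqVneq i e.
    by move: mon_h; rewrite monicE lead_coefE size_h => /eqP->; rewrite subrr.
  by rewrite nth_default ?subrr // size_h ltn_neqAle eq_sym neq_ie.
have [g size_g] := IHj (ltnW lt_je).
set G := map_poly iota g in size_g.
pose i := (e - j.+1)%N; have eq_i : (e - j = i.+1)%N by rewrite subnSK.
rewrite eq_i in size_g.
have lt_ie : (i < e)%N by rewrite -eq_i leq_subr.
have GE : G = h - (h - G) by rewrite subKr.
have lt_size : (size (h - G)%R < size h)%N by rewrite size_h ltnS (leq_trans size_g).
have size_G : size G = e.+1 by rewrite GE size_polyDl ?size_polyN.
have mon_G : G \is monic by rewrite GE monicE lead_coefDl ?size_polyN // -monicE.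
have size_term (n : 'I_k.+1) : h ^+ (k - n) * G ^+ n \is monic /\
    size (h ^+ (k - n) * G ^+ n) = (e * k).+1%N.
  have mon : h ^+ (k - n) * G ^+ n \is monic by rewrite monicMl monic_exp.
  split=> //; rewrite -[LHS]prednK ?size_poly_gt0 ?monic_neq0 //.
  rewrite size_Mmonic ?monic_exp ?monic_neq0 ?monic_exp //.
  have hs (p : {poly L}) m : p \is monic -> size p = e.+1 -> size (p ^+ m) = (e * m).+1%N.
    move=> mon_p size_p; rewrite -[LHS]prednK ?size_poly_gt0 ?monic_neq0 ?monic_exp //.
    by rewrite size_exp size_p.
  by rewrite !hs //= addnS /= -mulnDr subnK // -ltnS.
(* The difference of the powers is [h - G] times a sum of [k.+1] monic polynomials of degree
   [e * k], so its coefficient at [i + e * k] is [k.+1] times that of [h - G] at [i]. *)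
have key : (h - G)`_i *+ k.+1 = iota (f - g ^+ k.+1)`_(i + e * k)%N.
  rewrite -coef_map /= rmorphB rmorphXn /= -h_k -/G subrXX.
  rewrite (coef_mul_top size_g) ?coef_sum /=.
    rewrite -[k.+1 in LHS]card_ord -sumr_const mulr_sumr; apply: eq_bigr => n _.
    have [/monicP] := size_term n; rewrite lead_coefE => + eq_s.
    by rewrite eq_s /= => ->; rewrite mulr1.
  apply: (leq_trans (size_sum _ _ _)); apply/bigmax_leqP => n _.
  by rewrite (size_term n).2.
exists (g + (u * (f - g ^+ k.+1)`_(i + e * k)%N) *: 'X^i); rewrite -/i.
apply/leq_sizeP => n le_in; rewrite rmorphD /= map_polyZ map_polyXn -/G.
rewrite opprD addrA coefB coefZ coefXn.
have [->|neq_ni] := eqVneq n i.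
  have uk1L : iota u * k.+1%:R = 1 by rewrite -(rmorph_nat iota) -rmorphM uk1 rmorph1.
  by rewrite mulr1 rmorphM -key -mulr_natl mulrA uk1L mul1r subrr.
rewrite mulr0 subr0 nth_default // (leq_trans size_g) //.
by rewrite ltn_neqAle eq_sym neq_ni.
Qed.

(** * Multivariate polynomials *)

Definition euler (n : nat) (R : comNzRingType) (p : {mpoly R[n]}) :=
  \sum_i 'X_i * p^`M(i).


Lemma mpolyX_mderiv (n : nat) (R : comNzRingType) (i : 'I_n) m :
  'X_i * ('X_[m] : {mpoly R[n]})^`M(i) = 'X_[m] *+ m i.
Proof.
rewrite mderivX -scalerAr -mpolyXD scaler_nat.
case: (posnP (m i)) => [->|m_gt0]; first by rewrite !mulr0n.
by rewrite addmC submK // lep1mP -lt0n.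
Qed.

Lemma mcoeff_euler (n : nat) (R : comNzRingType) (p : {mpoly R[n]}) m :
  (euler p)@_m = p@_m *+ mdeg m.
Proof.
have -> : euler p = \sum_(m' <- msupp p) p@_m' *: ('X_[m'] *+ mdeg m').
  rewrite /euler {1}[p]mpolyE.
  under eq_bigr => i _ do rewrite raddf_sum mulr_sumr.
  rewrite exchange_big; apply: eq_bigr => m' _ /=.
  rewrite mdegE -sumrMnr scaler_sumr; apply: eq_bigr => i _.
  by rewrite mderivZ -scalerAr mpolyX_mderiv.
rewrite [in RHS](mpolyE p) !(raddf_sum (mcoeff m)) -sumrMnl.
apply: eq_bigr => m' _ /=; rewrite !mcoeffZ mcoeffMn mcoeffX mulrnAr.
by have [->|] := eqVneq m' m; rewrite ?mulr0 ?mul0rn.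
Qed.

Lemma eulerM (n : nat) (R : comNzRingType) (p q : {mpoly R[n]}) :
  euler (p * q) = euler p * q + p * euler q.
Proof.
rewrite /euler mulr_suml mulr_sumr -big_split; apply: eq_bigr => i _ /=.
by rewrite mderivM; ring.
Qed.

Lemma euler_exp (n : nat) (R : comNzRingType) (p : {mpoly R[n]}) k :
  euler (p ^+ k.+1) = euler p * p ^+ k *+ k.+1.
Proof.
elim: k => [|k IHk]; first by rewrite expr1 mulr1.
by rewrite exprS eulerM IHk [in RHS]mulrSr exprS; ring.
Qed.

Lemma euler_dhomog (n : nat) (R : comNzRingType) (p : {mpoly R[n]}) d :
  p \is d.-homog -> euler p = p *+ d.
Proof.
move=> hom_p; apply/mpolyP => m; rewrite mcoeff_euler mcoeffMn.
have [->//|neq_m] := eqVneq (mdeg m) d.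
by rewrite (dhomog_nemf_coeff hom_p neq_m) !mul0rn.
Qed.

(** The Euler operator multiplies each monomial by its degree. Applied to the power, it shows after
    cancellation that [p] is an eigenvector with eigenvalue [e]; in characteristic zero only
    monomials of degree [e] can then occur. *)
Lemma dhomog_root (n : nat) (R : idomainType) (p : {mpoly R[n]}) (e k : nat) :
    [pchar R] =i pred0 -> p ^+ k.+1 \is (e * k.+1).-homog ->
  p \is e.-homog.
Proof.
move=> char0 hom_pk; have [->|p_neq0] := eqVneq p 0; first exact: dhomog0.
have k_neq0 : k.+1%:R != 0 :> {mpoly R[n]}.
  by rewrite -mpolyC_nat mpolyC_eq0 ((pcharf0P _).1 char0).
have euler_p : euler p = p *+ e.
  have := euler_dhomog hom_pk; rewrite euler_exp exprS mulrnA -[in RHS]mulrnAl => /eqP.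
  rewrite -subr_eq0 -mulrnBl -mulrBl -(mulr_natl (_ * _)) !mulf_eq0.
  rewrite (negPf k_neq0) expf_eq0 (negPf p_neq0).
  by rewrite andbF orbF subr_eq0 => /eqP.
apply/dhomogP => m; rewrite mcoeff_msupp => pm_neq0.
apply: (mulrn_inj_char0 char0 pm_neq0).
by rewrite /= -mcoeff_euler euler_p mcoeffMn.
Qed.

(** Widening the coefficients and evaluating at the last variable undoes [muni]. *)
Lemma muni_inj (n : nat) (R : comNzRingType) : injective (@muni n R).
Proof.
apply: (can_inj (g := fun q => (mpwiden q).['X_ord_max])) => p.
rewrite muniE [RHS]mpolyE raddf_sum horner_sum; apply: eq_bigr => m _ /=.
rewrite mpwidenZ hornerZ rmorphXn /= mpwidenX hornerXn mwidenZ -scalerAl.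
rewrite mpolyXE_id rmorph_prod [in RHS]mpolyXE_id big_ord_recr /=.
congr (_ *: (_ * _)); apply: eq_bigr => i _.
by rewrite rmorphXn /= mnmE mwidenX mnmwiden1.
Qed.

Lemma exists_nonroot (R : idomainType) (p : {poly R}) :
  [pchar R] =i pred0 -> p != 0 -> exists t, p.[t] != 0.
Proof.
move=> char0 p_neq0; pose s := [seq n%:R : R | n <- iota 0 (size p)].
have [all_s|/allPn[t _ pt]] := boolP (all (root p) s); last by exists t.
have uniq_s : uniq s.
  by rewrite map_inj_uniq ?iota_uniq //; apply: mulrn_inj_char0 (oner_neq0 R).
by have := max_poly_roots p_neq0 all_s uniq_s; rewrite size_map size_iota ltnn.
Qed.

(** By induction on [n]: a point where the leading coefficient in the last variable is nonzero
    leaves a nonzero polynomial in that variable. *)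
Lemma exists_meval_neq0 (n : nat) (R : idomainType) (p : {mpoly R[n]}) :
  [pchar R] =i pred0 -> p != 0 -> exists v, p.@[v] != 0.
Proof.
move=> char0; elim: n p => [|n IHn] p p_neq0.
  have def_p : p = (p@_0)%:MP.
    apply/mpolyP => m; have -> : m = 0%MM by apply/mnmP; case.
    by rewrite mcoeffC eqxx mulr1.
  by exists (fun=> 0); rewrite def_p mevalC -(mpolyC_eq0 0) -def_p.
have q_neq0 : muni p != 0 by rewrite -(muni0 n R) (inj_eq (@muni_inj n R)).
have [|v qv] := IHn (lead_coef (muni p)); first by rewrite lead_coef_eq0.
have [|t qvt] := @exists_nonroot R (map_poly (meval v) (muni p)) char0.
  apply: contraNneq qv => /(congr1 (fun q : {poly R} => q`_(size (muni p)).-1)).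
  by rewrite coef_map coef0 lead_coefE => /= ->.
pose w (i : 'I_n.+1) := if unlift ord_max i is Some j then v j else t.
exists w; suff -> : p.@[w] = (map_poly (meval v) (muni p)).[t] by [].
rewrite mevalE muniE raddf_sum horner_sum; apply: eq_bigr => m _ /=.
rewrite !map_polyZ map_polyXn hornerZ hornerXn /= mevalZ mevalX -mulrA.
rewrite big_ord_recr /= {2}/w unlift_none; congr (_ * (_ * _)).
apply: eq_bigr => i _; rewrite mnmE; congr (_ ^+ _).
have -> : widen_ord (leqnSn n) i = lift ord_max i.
  by apply: val_inj; rewrite /= /bump leqNgt ltn_ord.
by rewrite /w liftK.
Qed.

(** * Binary forms and their dehomogenization *)

Lemma diag_opXn (R : nzRingType) (w : nat -> R) n :
  diag_op w 'X^n = w n *: 'X^n.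
Proof.
apply/polyP => k; rewrite coef_diag_op coefZ coefXn.
by have [->|] := eqVneq k n; rewrite ?mulr0.
Qed.

Lemma dhomog_mderiv (n : nat) (R : nzRingType) (p : {mpoly R[n]}) d i :
  p \is d.-homog -> p^`M(i) \is d.-1.-homog.
Proof.
move=> hom_p; apply/dhomogP => m; rewrite mcoeff_msupp mcoeff_mderiv /=.
have [<- _|neq] := eqVneq (mdeg (m + U_(i))) d; first by rewrite mdegD mdeg1 addn1.
by rewrite (dhomog_nemf_coeff hom_p neq) mul0rn eqxx.
Qed.

Lemma mderiv_exp (n : nat) (R : comNzRingType) (p : {mpoly R[n]}) i k :
  (p ^+ k)^`M(i) = p^`M(i) * p ^+ k.-1 *+ k.
Proof.
case: k => [|k]; first by rewrite expr0 mulr0n -(mpolyC1 n) mderivC.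
elim: k => [|k IHk]; first by rewrite expr1 mulr1.
by rewrite exprS mderivM IHk /= [in RHS]mulrSr exprS; ring.
Qed.

(** The map [psi] serves to specialize the generic line at the same time and, where needed, to move
    the coefficients into a field. *)
Definition dehom (K L : comNzRingType) (psi : {rmorphism K -> L})
    (p : {mpoly K[2]}) : {poly L} :=
  mmap (polyC \o psi) (fun i => if i == i1 then 'X else 1) p.

HB.instance Definition _ (K L : comNzRingType) (psi : {rmorphism K -> L}) :=
  GRing.RMorphism.copy (dehom psi)
    (mmap (polyC \o psi) (fun i => if i == i1 then 'X else 1)).

Section Dehomogenization.

Variables (K L : comNzRingType) (psi : {rmorphism K -> L}).
Implicit Types (p : {mpoly K[2]}) (m : 'X_{1..2}).

Lemma big_binary (T : Type) (idx : T) (op : Monoid.law idx) (F : 'I_2 -> T) :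
  \big[op/idx]_i F i = op (F i1) (F i2).
Proof.
rewrite big_ord_recl big_ord1.
by congr (op (F _) (F _)); apply: val_inj.
Qed.

Lemma mdeg_binary m : mdeg m = (m i1 + m i2)%N.
Proof. by rewrite mdegE big_binary. Qed.

Lemma dehomX m : dehom psi 'X_[m] = 'X^(m i1).
Proof. by rewrite /dehom mmapX /mmap1 big_binary /= expr1n mulr1. Qed.

Lemma dehomZ c p : dehom psi (c *: p) = psi c *: dehom psi p.
Proof. by rewrite /dehom mmapZ /= mul_polyC. Qed.

Lemma dehomE p : dehom psi p = \sum_(m <- msupp p) psi p@_m *: 'X^(m i1).
Proof.
rewrite {1}[p]mpolyE rmorph_sum; apply: eq_bigr => m _.
by rewrite /= dehomZ dehomX.
Qed.

Lemma size_dehom p d : p \is d.-homog -> (size (dehom psi p) <= d.+1)%N.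
Proof.
move=> /dhomogP hom_p; rewrite dehomE; apply: (leq_trans (size_sum _ _ _)).
rewrite big_seq; elim/big_ind: _ => // [x y|m /hom_p deg_m].
  by rewrite geq_max => -> ->.
apply: (leq_trans (size_scale_leq _ _)).
by rewrite size_polyXn ltnS -deg_m /= mdeg_binary leq_addr.
Qed.

Lemma dehom_mderiv1 p : dehom psi p^`M(i1) = (dehom psi p)^`().
Proof.
rewrite {1}[p]mpolyE [in RHS]dehomE (raddf_sum (mderiv i1)).
rewrite (raddf_sum (dehom psi)) (raddf_sum (@deriv L)); apply: eq_bigr => m _ /=.
rewrite mderivZ mderivX !dehomZ dehomX rmorph_nat scaler_nat derivZ derivXn.
by rewrite mnmBE mnm1E eqxx subn1.
Qed.

(** Euler's identity at lambda2 = 1 trades the second partial derivative for the first. *)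
Lemma dehom_mderiv2 p d : p \is d.-homog ->
  dehom psi p^`M(i2) = dehom psi p *+ d - 'X * (dehom psi p)^`().
Proof.
move=> hom_p; rewrite -rmorphMn -(euler_dhomog hom_p) /euler big_binary.
rewrite rmorphD !rmorphM /= dehom_mderiv1 !dehomX !mnm1E eqxx /= expr1 expr0.
by rewrite mul1r [_ + dehom psi _]addrC addrK.
Qed.

(** The factor ['X^(r - j)] restores the exponent lowered by differentiation, and homogeneity gives
    the exponent of the second variable from that of the first. Where the subtraction of exponents
    truncates, the falling factorial is zero. *)
Lemma dehom_mderivm p d r j : p \is d.-homog -> (j <= r)%N ->
  dehom psi p^`M[U_(i1) *+ (r - j) + U_(i2) *+ j] * 'X^(r - j) =
    diag_op (fun n => (indicial_weight d r j n)%:R) (dehom psi p).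
Proof.
move=> /dhomogP hom_p le_jr; rewrite [in RHS]dehomE diag_op_sum.
rewrite mderivmE rmorph_sum mulr_suml !big_seq; apply: eq_bigr => m /hom_p /=.
rewrite mdeg_binary => deg_m; rewrite dehomZ dehomX rmorphM rmorph_nat diag_opXn.
rewrite -scalerA -scalerAl; congr (_ *: _); rewrite big_binary /indicial_weight /=.
rewrite mnmBE !mnmDE !mulmnE !mnm1E /= !mul1n !mul0n addn0 add0n.
rewrite -deg_m addKn; have [le_m|lt_m] := leqP (r - j) (m i1).
  by rewrite -scalerAl -exprD subnK.
by rewrite ffact_small // mul0n !scale0r mul0r.
Qed.

End Dehomogenization.

(** * Vanishing of [frakG] and the kernel of the transvectant *)

Lemma transvectant1_homog (k : fieldType) (K : comAlgType k) (r d : nat)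
    (A F : {mpoly K[2]}) :
    (0 < r)%N -> (0 < d)%N -> A \is r.-homog -> F \is d.-homog ->
  transvectant1 r d A F \is (r + d - 2).-homog.
Proof.
move=> r_gt0 d_gt0 hom_A hom_F.
have -> : (r + d - 2 = r.-1 + d.-1)%N.
  by rewrite -{1}(prednK r_gt0) -{1}(prednK d_gt0) addSn addnS subn2.
by apply/dhomogZ/rpredB; apply: dhomogM; apply: dhomog_mderiv.
Qed.

Lemma binary_monomial_homog (K : comNzRingType) (r i : nat) : (i <= r)%N ->
  ('X_i1 ^+ (r - i) * 'X_i2 ^+ i : {mpoly K[2]}) \is r.-homog.
Proof.
move=> le_ir; rewrite -{2}(subnK le_ir) -[(r - i)%N in X in X.-homog]mul1n.
rewrite -[X in (_ + X)%N]mul1n; apply: dhomogM; apply: dhomogMn;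
  by rewrite dhomogX /= mdeg1.
Qed.

Section TransvectantKernel.

Variables (k : fieldType) (K : comAlgType k).

(** Once the second partial derivatives are eliminated, the two terms containing ['X] and both first
    derivatives cancel. *)
Lemma dehom_transvectant1 (L : comNzRingType) (psi : {rmorphism K -> L})
    (r d : nat) (A F : {mpoly K[2]}) :
    A \is r.-homog -> F \is d.-homog ->
  dehom psi (transvectant1 r d A F) = psi ((r * d)%N%:R^-1%:A) *:
    ((dehom psi A)^`() * dehom psi F *+ d - dehom psi A * (dehom psi F)^`() *+ r).
Proof.
move=> hom_A hom_F; rewrite dehomZ rmorphB !rmorphM /= !dehom_mderiv1.
rewrite (dehom_mderiv2 psi hom_A) (dehom_mderiv2 psi hom_F); congr (_ *: _).
by ring.
Qed.

Lemma mulr_invr_nat_alg (L : comNzRingType) (psi : {rmorphism K -> L}) n :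
  n%:R != 0 :> k -> psi (n%:R^-1%:A) * n%:R = 1.
Proof.
move=> n_neq0; rewrite -(rmorph_nat psi) -rmorphM -(rmorph_nat (in_alg K)).
by rewrite -[_%:A]/(in_alg K _) -rmorphM mulVf // !rmorph1.
Qed.

Lemma frakG_eq0_deriv_proportional (L : fieldType) (psi : {rmorphism K -> L})
    (r d : nat) (F : {mpoly K[2]}) :
    [pchar k] =i pred0 -> (0 < r)%N -> (1 < d)%N -> F \is d.-homog ->
    frakG r d F = 0 ->
  exists2 a : {poly L}, a != 0 &
    a^`() * dehom psi F *+ d = a * (dehom psi F)^`() *+ r.
Proof.
move=> char0 r_gt0 d_gt1 hom_F G0.
have d_gt0 := ltnW d_gt1.
have rd_neq0 : (r * d)%N%:R != 0 :> k.
  by rewrite ((pcharf0P _).1 char0) muln_eq0 negb_or -!lt0n r_gt0.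
pose s := psi ((r * d)%N%:R^-1%:A).
have srd : s * (r * d)%N%:R = 1 by apply: mulr_invr_nat_alg.
have s_neq0 : s != 0.
  by apply: contra_eq_neq srd => ->; rewrite mul0r eq_sym oner_neq0.
have charL : [pchar L] =i pred0.
  apply/pcharf0P => n; have := (pcharf0P _).1 char0 n.
  have [->|n_gt0] := posnP n; first by rewrite !eqxx.
  have [|n_neq0 _] := eqVneq (n%:R : k) 0; first by case: n n_gt0.
  have nV := mulr_invr_nat_alg psi n_neq0.
  apply/negbTE.
  by apply: contra_eq_neq nV => ->; rewrite mulr0 eq_sym oner_neq0.
(* This is the order of the forms [C_form]; it is at least [r] because [d] is at least 2. *)
pose m := (r + d - 2)%N; have le_rm : (r <= m)%N by rewrite /m -addnBA // leq_addr.
have hom_C (i : 'I_r.+1) : C_form r d F i \is m.-homog.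
  by apply: transvectant1_homog => //; apply: binary_monomial_homog; rewrite -ltnS.
pose c (i : 'I_r.+1) := dehom psi (C_form r d F i).
pose w (j : 'I_r.+1) n : L := (indicial_weight m r j n)%:R.
have [|||x x_neq0 xc0] := @diag_wronskian_dependent L r m c w.
- by move=> i; apply: size_dehom.
- by move=> l nz_l; apply: indicial_few_roots.
- set M := \matrix_(i, j) _.
  (* Scaling column [j] by ['X^(r - j)] makes its operator diagonal and keeps the determinant
     zero. *)
  have -> : M = map_mx (dehom psi) (\matrix_(i < r.+1, j < r.+1)
      (C_form r d F i)^`M[U_(i1) *+ (r - j) + U_(i2) *+ j])
      *m diag_mx (\row_j 'X^(r - j)).
    apply/matrixP => i j; rewrite mul_mx_diag !mxE.
    by rewrite (dehom_mderivm psi (hom_C i)) // -ltnS.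
  by rewrite det_mulmx det_map_mx -/(frakG r d F) G0 rmorph0 mul0r.
(* The transvectant is linear in its first argument, so the relation among the [c i] is the
   differential equation for the combination of monomials with the same coefficients. *)
pose a := \sum_i x 0 i *: dehom psi ('X_i1 ^+ (r - i) * 'X_i2 ^+ i).
exists a.
  have /rV0Pn[i0 xi0] := x_neq0; apply: contraNneq xi0 => a0.
  have := congr1 (fun p : {poly L} => p`_(r - i0)) a0.
  rewrite coef0 coef_sum (bigD1 i0) //= big1 ?addr0 => [|i neq_i].
    rewrite coefZ rmorphM !rmorphXn /= !dehomX !mnm1E /= expr1n mulr1 coefXn.
    by rewrite eqxx mulr1 => ->.
  rewrite coefZ rmorphM !rmorphXn /= !dehomX !mnm1E /= expr1n mulr1 coefXn.
  rewrite eqn_sub2lE -1?ltnS // val_eqE eq_sym (negPf neq_i) mulr0 //.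
apply/eqP; rewrite -subr_eq0; apply/eqP/(scalerI s_neq0); rewrite scaler0.
rewrite -[RHS]xc0 /a (raddf_sum (@deriv L)) !mulr_suml -!sumrMnl -sumrB scaler_sumr.
apply: eq_bigr => i _; rewrite /c dehom_transvectant1 // -/s; last first.
  by apply: binary_monomial_homog; rewrite -ltnS.
by rewrite /= derivZ -!scalerAl !scalerMnr -scalerBr !scalerA [s * _]mulrC.
Qed.

End TransvectantKernel.

Lemma binary_mnm_proj (r i : nat) :
  ((U_(i1) *+ (r - i) + U_(i2) *+ i)%MM i1 = (r - i)%N) *
  ((U_(i1) *+ (r - i) + U_(i2) *+ i)%MM i2 = i).
Proof.
split; rewrite mnmDE !mulmnE !mnm1E /= ?mul1n ?mul0n ?addn0 //.
Qed.

Lemma binary_mnmE (m : 'X_{1..2}) :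
  (U_(i1) *+ (mdeg m - m i2) + U_(i2) *+ m i2)%MM = m.
Proof.
apply/mnmP => i; have [->|->] : i = i1 \/ i = i2.
- by case: i => [[|[|//]] ?]; [left|right]; apply: val_inj.
- by rewrite binary_mnm_proj mdeg_binary addnK.
by rewrite binary_mnm_proj.
Qed.

Lemma binary_form_expansion (K : comNzRingType) (r : nat) (A : {mpoly K[2]}) :
    A \is r.-homog ->
  A = \sum_(i < r.+1) A@_(U_(i1) *+ (r - i) + U_(i2) *+ i)%MM *:
        ('X_i1 ^+ (r - i) * 'X_i2 ^+ i).
Proof.
move=> hom_A; apply/mpolyP => m; rewrite (raddf_sum (mcoeff m)) /=.
under eq_bigr => i _ do rewrite !mpolyXn -mpolyXD mcoeffZ mcoeffX.
have [deg_m|neq_m] := eqVneq (mdeg m) r; last first.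
  rewrite (dhomog_nemf_coeff hom_A neq_m) big1 // => i _.
  have [eq_m|] := eqVneq; last by rewrite mulr0.
  by case/eqP: neq_m; rewrite -eq_m mdeg_binary !binary_mnm_proj subnK // -ltnS.
have lt_m : (m i2 < r.+1)%N by rewrite ltnS -deg_m mdeg_binary leq_addl.
have def_m : (U_(i1) *+ (r - m i2) + U_(i2) *+ m i2)%MM = m.
  by rewrite -deg_m binary_mnmE.
rewrite (bigD1 (Ordinal lt_m)) //= def_m eqxx mulr1 big1 ?addr0 // => i neq_i.
have [eq_m|] := eqVneq; last by rewrite mulr0.
by case/eqP: neq_i; apply: val_inj; rewrite /= -eq_m binary_mnm_proj.
Qed.

(** By linearity of the transvectant in [A], the coefficients of [A] form a left kernel vector of
    the matrix in [frakG]. *)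
Lemma transvectant1_kernel (k : fieldType) (K : comAlgType k) (r d : nat)
    (A F : {mpoly K[2]}) (j : nat) :
    A \is r.-homog -> transvectant1 r d A F = 0 ->
  \sum_(i < r.+1) (A@_(U_(i1) *+ (r - i) + U_(i2) *+ i))%:MP *
    (C_form r d F i)^`M[U_(i1) *+ (r - j) + U_(i2) *+ j] = 0.
Proof.
move=> hom_A AF0; set mj := (X in mderivm X).
have aC0 : \sum_(i < r.+1) (A@_(U_(i1) *+ (r - i) + U_(i2) *+ i)%MM) *:
    C_form r d F i = 0; last first.
  have := congr1 (mderivm mj) aC0; rewrite (raddf0 (mderivm mj)) => dC0.
  rewrite -[RHS]dC0 (raddf_sum (mderivm mj)).
  by apply: eq_bigr => i _ /=; rewrite mul_mpolyC -mderivmZ.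
rewrite -[RHS]AF0 [in RHS](binary_form_expansion hom_A) /transvectant1.
rewrite (raddf_sum (mderiv i1)) (raddf_sum (mderiv i2)) !mulr_suml -sumrB.
rewrite scaler_sumr; apply: eq_bigr => i _ /=.
by rewrite !mderivZ -!scalerAl -scalerBr !scalerA mulrC.
Qed.

(** Multiplying by the adjugate avoids division, so the entries may lie in a polynomial ring. *)
Lemma row_kernel_det (R : comNzRingType) n (M : 'M[R]_n) (v : 'rV[R]_n) i :
  v *m M = 0 -> \det M * v 0 i = 0.
Proof.
move=> vM0; have := congr1 (fun u => (u *m \adj M) 0 i) vM0.
by rewrite -mulmxA mul_mx_adj mul_mx_scalar mul0mx !mxE.
Qed.

Lemma frakG_mul_coeff (k : fieldType) (K : comAlgType k) (r d : nat)
    (A F : {mpoly K[2]}) m :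
    A \is r.-homog -> transvectant1 r d A F = 0 ->
  frakG r d F * (A@_m)%:MP = 0.
Proof.
move=> hom_A AF0; have [deg_m|neq_m] := eqVneq (mdeg m) r; last first.
  by rewrite (dhomog_nemf_coeff hom_A neq_m) mulr0.
have lt_m : (m i2 < r.+1)%N by rewrite ltnS -deg_m mdeg_binary leq_addl.
have -> : (A@_m)%:MP = (\row_(i < r.+1)
    (A@_(U_(i1) *+ (r - i) + U_(i2) *+ i))%:MP_[2]) 0 (Ordinal lt_m).
  by rewrite mxE /= -deg_m binary_mnmE.
apply: row_kernel_det; apply/rowP => j.
rewrite !mxE -[RHS](transvectant1_kernel j hom_A AF0).
by apply: eq_bigr => i _; rewrite !mxE.
Qed.

(** Leading coefficients multiply. The axiom stands in for an integral domain structure, since [K]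
    below is only a [comAlgType]. *)
Lemma mpoly_integral (R : nzRingType) (n : nat) :
  GRing.integral_domain_axiom R ->
  GRing.integral_domain_axiom {mpoly R[n]}.
Proof.
move=> intR p q pq0; have := mleadcM p q; rewrite pq0 mcoeff0 => /esym/intR.
by rewrite !mleadc_eq0.
Qed.

Lemma frakG_eq0_transvectant (k : fieldType) (K : comAlgType k) (r d : nat)
    (A F : {mpoly K[2]}) :
    GRing.integral_domain_axiom K ->
    A != 0 -> A \is r.-homog -> transvectant1 r d A F = 0 ->
  frakG r d F = 0.
Proof.
move=> intK A_neq0 hom_A AF0.
have := frakG_mul_coeff (mlead A) hom_A AF0.
move/(mpoly_integral intK)/orP=> [/eqP //|].
by rewrite mpolyC_eq0 mleadc_eq0 (negPf A_neq0).
Qed.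

(** The gradients of two powers of [g] are multiples of the gradient of [g], so [g ^+ b] has zero
    transvectant with [g ^+ c]. *)
Lemma frakG_exp (k : fieldType) (K : comAlgType k) (r d e b c : nat)
    (g : {mpoly K[2]}) :
    GRing.integral_domain_axiom K ->
    g \is e.-homog -> (0 < c)%N -> r = (e * b)%N ->
  frakG r d (g ^+ c) = 0.
Proof.
move=> intK hom_g c_gt0 def_r; have [->|g_neq0] := eqVneq g 0.
  (* For [g = 0] the power [g ^+ b] may vanish, but then any nonzero form of order [r] serves as
     [A]. *)
  apply: (@frakG_eq0_transvectant _ _ _ _ 'X_[U_(i1) *+ r]) => //.
  - by rewrite -msupp_eq0 msuppX.
  - by rewrite dhomogX /= mdegMn mdeg1 mul1n.
  by rewrite /transvectant1 expr0n gtn_eqF // !mderiv0 !mulr0 subrr scaler0.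
apply: (@frakG_eq0_transvectant _ _ _ _ (g ^+ b)) => //.
- elim: b {def_r} => [|b IHb]; first by rewrite expr0 oner_neq0.
  rewrite exprS; apply/eqP => /(mpoly_integral intK).
  by rewrite (negPf g_neq0) (negPf IHb).
- by rewrite def_r; apply: dhomogMn.
rewrite /transvectant1 !mderiv_exp.
rewrite [X in X - _](_ : _ = g^`M(i2) * g ^+ b.-1 *+ b * (g^`M(i1) * g ^+ c.-1 *+ c)).
  by rewrite subrr scaler0.
by ring.
Qed.

(** * Restriction of forms to a generic line *)

Lemma dhomog_bigprod (n : nat) (R : comNzRingType) (I : Type) (s : seq I)
    (p : I -> {mpoly R[n]}) (d : I -> nat) :
    (forall i, p i \is (d i).-homog) ->
  \prod_(i <- s) p i \is (\sum_(i <- s) d i).-homog.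
Proof.
move=> hom_p; elim/big_rec2: _ => [|i d' p' _]; first exact: dhomog1.
by move/(dhomogM (hom_p i)).
Qed.

Lemma dhomogC (n : nat) (R : comNzRingType) (c : R) : c%:MP_[n] \is 0.-homog.
Proof. by rewrite -[c%:MP]mulr1 mul_mpolyC; apply/dhomogZ/dhomog1. Qed.

Section RestrictLine.

Variables (k : fieldType) (n : nat).
Implicit Type Gamma : {mpoly k[n]}.

Lemma restrict_line_exp Gamma c :
  restrict_line (Gamma ^+ c) = restrict_line Gamma ^+ c.
Proof.
exact: (rmorphXn (mmap (@mpolyC 2 _ \o @mpolyC (n + n) k)
  (fun i : 'I_n => 'X_i1 * ('X_(lshift n i))%:MP
                      + 'X_i2 * ('X_(rshift n i))%:MP))).
Qed.

Lemma restrict_line_homog Gamma d :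
  Gamma \is d.-homog -> restrict_line Gamma \is d.-homog.
Proof.
have hom_line (a b : {mpoly k[n + n]}) :
    'X_i1 * a%:MP_[2] + 'X_i2 * b%:MP_[2] \is 1.-homog.
  by apply: rpredD; apply: (dhomogM (d := 1) (e := 0)); rewrite ?dhomogC //;
    rewrite dhomogX /= mdeg1.
move=> /dhomogP hom_G; rewrite /restrict_line /mmap big_seq.
apply: rpred_sum => m m_in; have <- : mdeg m = d := hom_G m m_in.
apply: (dhomogM (d := 0) (e := mdeg m)); first exact: dhomogC.
rewrite /mmap1 mdegE; apply: dhomog_bigprod => i.
by rewrite -{2}[m i]mul1n; apply: dhomogMn.
Qed.

Lemma dehom_restrict_line (L : comNzRingType) (psi : {rmorphism {mpoly k[n + n]} -> L})
    Gamma :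
  dehom psi (restrict_line Gamma) =
    \sum_(m <- msupp Gamma) (psi (Gamma@_m)%:MP)%:P *
      \prod_(i < n) ('X * (psi 'X_(lshift n i))%:P + (psi 'X_(rshift n i))%:P) ^+ m i.
Proof.
rewrite /restrict_line /mmap rmorph_sum; apply: eq_bigr => m _ /=.
have dehomC c : dehom psi c%:MP_[2] = (psi c)%:P by rewrite /dehom mmapC.
rewrite rmorphM /= dehomC; congr (_ * _); rewrite /mmap1 rmorph_prod.
apply: eq_bigr => i _; rewrite rmorphXn rmorphD !rmorphM /= !dehomC !dehomX.
by rewrite !mnm1E /= mul1r.
Qed.

End RestrictLine.

(** * Restriction to the lines through a point *)

Lemma coef_prod_top (R : comNzRingType) (I : Type) (s : seq I)
    (q : I -> {poly R}) (e : I -> nat) :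
    (forall i, (size (q i) <= (e i).+1)%N) ->
  (size (\prod_(i <- s) q i)%R <= (\sum_(i <- s) e i).+1)%N /\
  (\prod_(i <- s) q i)`_(\sum_(i <- s) e i) = \prod_(i <- s) (q i)`_(e i).
Proof.
move=> size_q; elim: s => [|i s [IHsize IHcoef]].
  by rewrite !big_nil size_poly1 coef1.
rewrite !big_cons; split; last by rewrite coef_mul_top // IHcoef.
apply: (leq_trans (size_polyMleq _ _)).
by have := leq_add (size_q i) IHsize; rewrite addSn addnS; case: (_ + _)%N.
Qed.

Lemma coef_exp_top (R : comNzRingType) (q : {poly R}) (k : nat) :
    (size q <= 2)%N ->
  (size (q ^+ k)%R <= k.+1)%N /\ (q ^+ k)`_k = q`_1 ^+ k.
Proof.
move=> size_q.
have := @coef_prod_top R 'I_k (index_enum 'I_k) (fun=> q) (fun=> 1%N) (fun=> size_q).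
by rewrite !prodr_const sum_nat_const card_ord muln1.
Qed.

Lemma dehom_comp (K S L : comNzRingType) (phi : {rmorphism K -> S})
    (iota : {rmorphism S -> L}) (p : {mpoly K[2]}) :
  dehom (iota \o phi) p = map_poly iota (dehom phi p).
Proof.
rewrite !dehomE (raddf_sum (map_poly iota)); apply: eq_bigr => m _ /=.
by rewrite map_polyZ map_polyXn.
Qed.

(* The substitution [p := v, q := x]. *)
Definition line_through (k : fieldType) (n : nat) (v : 'I_n -> k)
    (c : {mpoly k[n + n]}) : {mpoly k[n]} :=
  mmap (@mpolyC n k)
    (fun i => match split i with inl j => (v j)%:MP | inr j => 'X_j end) c.

HB.instance Definition _ (k : fieldType) (n : nat) (v : 'I_n -> k) :=
  GRing.RMorphism.copy (line_through v) (mmap (@mpolyC n k)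
    (fun i => match split i with inl j => (v j)%:MP | inr j => 'X_j end)).

Lemma line_throughC (k : fieldType) (n : nat) (v : 'I_n -> k) c :
  line_through v c%:MP = c%:MP.
Proof. exact: mmapC. Qed.

Lemma line_through_lshift (k : fieldType) (n : nat) (v : 'I_n -> k) i :
  line_through v 'X_(lshift n i) = (v i)%:MP.
Proof. by rewrite /line_through mmapX mmap1U (unsplitK (inl i)). Qed.

Lemma line_through_rshift (k : fieldType) (n : nat) (v : 'I_n -> k) i :
  line_through v 'X_(rshift n i) = 'X_i.
Proof. by rewrite /line_through mmapX mmap1U (unsplitK (inr i)). Qed.

Section DehomRestrictLine.

Variables (k : fieldType) (n : nat) (L : comNzRingType).
Variables (psi : {rmorphism {mpoly k[n + n]} -> L}) (Gamma : {mpoly k[n]}).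

(** Setting ['X] to zero leaves the value of [Gamma] at the image of the point q. *)
Lemma dehom_restrict_line0 : (dehom psi (restrict_line Gamma))`_0 =
  \sum_(m <- msupp Gamma) psi (Gamma@_m)%:MP *
    \prod_(i < n) psi 'X_(rshift n i) ^+ m i.
Proof.
rewrite -horner_coef0 dehom_restrict_line horner_sum; apply: eq_bigr => m _.
rewrite hornerM hornerC horner_prod; congr (_ * _); apply: eq_bigr => i _.
by rewrite horner_exp hornerD hornerM hornerX !hornerC mul0r add0r.
Qed.

(** Each substituted factor is linear in ['X] with slope a coordinate of p, so the top coefficient
    is the value of [Gamma] at the image of p. *)
Lemma dehom_restrict_line_top d : Gamma \is d.-homog ->
  (dehom psi (restrict_line Gamma))`_d =
    \sum_(m <- msupp Gamma) psi (Gamma@_m)%:MP *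
      \prod_(i < n) psi 'X_(lshift n i) ^+ m i.
Proof.
move=> /dhomogP hom_Gamma; rewrite dehom_restrict_line coef_sum.
apply: eq_big_seq => m m_in; have <- : mdeg m = d := hom_Gamma m m_in.
rewrite coefCM mdegE; congr (_ * _).
pose q i := 'X * (psi 'X_(lshift n i))%:P + (psi 'X_(rshift n i))%:P.
have size_q i : (size (q i) <= 2)%N.
  by rewrite /q mulrC size_MXaddC; case: ifP => // _; rewrite ltnS size_polyC leq_b1.
have [_ ->] := @coef_prod_top _ _ (index_enum 'I_n) (fun i => q i ^+ m i) m
  (fun i => (coef_exp_top (m i) (size_q i)).1).
apply: eq_bigr => i _; rewrite (coef_exp_top _ (size_q i)).2.
by rewrite /q coefD coefXM coefC /= coefC addr0.
Qed.

End DehomRestrictLine.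

Lemma dehom_line_through0 (k : fieldType) (n : nat) (v : 'I_n -> k)
    (Gamma : {mpoly k[n]}) :
  (dehom (line_through v) (restrict_line Gamma))`_0 = Gamma.
Proof.
rewrite dehom_restrict_line0 [RHS]mpolyE; apply: eq_bigr => m _.
rewrite /= line_throughC mul_mpolyC mpolyXE_id.
by congr (_ *: _); apply: eq_bigr => i _; rewrite /= line_through_rshift.
Qed.

Lemma dehom_line_through_top (k : fieldType) (n : nat) (v : 'I_n -> k)
    (Gamma : {mpoly k[n]}) d :
  Gamma \is d.-homog ->
  (dehom (line_through v) (restrict_line Gamma))`_d = (Gamma.@[v])%:MP.
Proof.
move=> hom_Gamma; rewrite dehom_restrict_line_top // mevalE rmorph_sum.
apply: eq_bigr => m _ /=; rewrite /= line_throughC.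
rewrite mpolyCM rmorph_prod; congr (_ * _); apply: eq_bigr => i _ /=.
by rewrite rmorphXn /= line_through_lshift.
Qed.

(** * Descent from the fraction field and the equivalence *)

Lemma pchar0_inj_rmorph (R S : idomainType) (h : {rmorphism R -> S}) :
  injective h -> [pchar R] =i pred0 -> [pchar S] =i pred0.
Proof.
move=> inj_h /pcharf0P char0; apply/pcharf0P => n.
by rewrite -(rmorph_nat h) -(rmorph0 h) (inj_eq inj_h) char0.
Qed.

(** The equation yields a monic root of [c *: f] over the fraction field. Since [c] and [u] invert
    the top coefficient and the exponent within [S], the root descends to [S]. *)
Lemma root_over_fraction_descent (S : idomainType) (f : {poly S})
    (a : {poly {fraction S}}) (d r : nat) (u c : S) :
    [pchar S] =i pred0 -> (0 < d)%N ->
    (size f <= d.+1)%N -> c * f`_d = 1 -> u * (d %/ gcdn r d)%:R = 1 ->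
    a != 0 ->
    a^`() * map_poly (@tofrac S) f *+ d = a * (map_poly (@tofrac S) f)^`() *+ r ->
  exists g, g ^+ (d %/ gcdn r d) = c *: f.
Proof.
move=> char0 d_gt0 size_f cf ud a_neq0 eq_af.
have inj_frac : injective (@tofrac S) by move=> x y /eqP; rewrite tofrac_eq => /eqP.
have charL := pchar0_inj_rmorph inj_frac char0.
set e := gcdn r d in ud *; have e_gt0 : (0 < e)%N by rewrite gcdn_gt0 d_gt0 orbT.
pose k := (d %/ e)%N; pose l := (r %/ e)%N.
have def_d : d = (e * k)%N by rewrite mulnC divnK // dvdn_gcdr.
have def_r : r = (e * l)%N by rewrite mulnC divnK // dvdn_gcdl.
have k_gt0 : (0 < k)%N by rewrite divn_gt0 // dvdn_leq // dvdn_gcdr.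
have co_kl : coprime k l.
  rewrite /coprime -(eqn_pmul2l e_gt0) muln_gcdr -def_d -def_r muln1.
  by rewrite gcdnC.
pose F := map_poly (@tofrac S) (c *: f).
have coefF : (c *: f)`_d = 1 by rewrite coefZ.
have size_cf : size (c *: f) = d.+1.
  apply/eqP; rewrite eqn_leq (leq_trans (size_scale_leq _ _)) //=.
  rewrite ltnNge; apply/negP => /leq_sizeP/(_ d (leqnn d)).
  by rewrite coefF => /eqP; rewrite oner_eq0.
have size_F : size F = (e * k).+1.
  by rewrite size_map_inj_poly ?rmorph0 // size_cf def_d.
have mon_F : F \is monic.
  by rewrite monicE lead_coefE size_F coef_map -def_d coefF /= rmorph1.
(* Cancelling the common factor [e] of [d] and [r] leaves coprime multipliers. *)
have eq_aF : a^`() * F *+ k = a * F^`() *+ l.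
  have /pcharf0P charP := pchar0_inj_rmorph (@polyC_inj {fraction S}) charL.
  have e_neq0 : e%:R != 0 :> {poly {fraction S}}.
    by rewrite charP -lt0n.
  apply: (mulIf e_neq0); rewrite !mulr_natr -!mulrnA ![(_ * e)%N]mulnC -def_d -def_r.
  by rewrite /F map_polyZ derivZ -!scalerAr !scalerMnr eq_af.
have [h [mon_h size_h h_k]] :=
  root_of_deriv_proportional charL co_kl k_gt0 a_neq0 mon_F size_F eq_aF.
have [||g def_h] := @monic_root_descent S _ (@tofrac S) h (c *: f) k.-1 e u _
  mon_h size_h.
- by rewrite prednK.
- by rewrite prednK.
exists g; apply: (map_inj_poly inj_frac (rmorph0 _)).
by rewrite rmorphXn /= -def_h h_k.
Qed.

Lemma mpoly_pchar0 (n : nat) (R : idomainType) :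
  [pchar R] =i pred0 -> [pchar {mpoly R[n]}] =i pred0.
Proof.
apply: (pchar0_inj_rmorph (h := @mpolyC n R)) => x y /eqP.
by rewrite -subr_eq0 -mpolyCB mpolyC_eq0 subr_eq0 => /eqP.
Qed.

Lemma clebsch_transfer_root (k : fieldType) (n r d : nat)
    (Gamma : {mpoly k[n]}) :
    [pchar k] =i pred0 -> (0 < r)%N -> (1 < d)%N -> Gamma \is d.-homog ->
    Gamma != 0 -> clebsch_transfer r d Gamma = 0 ->
  exists c G, c != 0 /\ G ^+ (d %/ gcdn r d) = c *: Gamma.
Proof.
move=> char0 r_gt0 d_gt1 hom_Gamma Gamma_neq0 transfer0.
have d_gt0 := ltnW d_gt1.
have [v v_neq0] := exists_meval_neq0 char0 Gamma_neq0.
pose f := dehom (line_through v) (restrict_line Gamma).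
have hom_line := restrict_line_homog hom_Gamma.
have charS := mpoly_pchar0 n char0.
have [a a_neq0] := frakG_eq0_deriv_proportional
  (@tofrac {mpoly k[n]} \o line_through v) char0 r_gt0 d_gt1 hom_line transfer0.
rewrite dehom_comp => eq_af.
have k_neq0 : (d %/ gcdn r d)%:R != 0 :> k.
  rewrite ((pcharf0P _).1 char0) -lt0n divn_gt0 ?gcdn_gt0 ?d_gt0 ?orbT //.
  by rewrite dvdn_leq // dvdn_gcdr.
have [] := @root_over_fraction_descent _ f a d r
  ((d %/ gcdn r d)%:R^-1)%:MP (Gamma.@[v])^-1%:MP charS d_gt0 _ _ _ a_neq0 eq_af.
- exact: size_dehom.
- by rewrite /f dehom_line_through_top // -mpolyCM mulVf.
- by rewrite -mpolyC_nat -mpolyCM mulVf.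
move=> g g_k; exists (Gamma.@[v])^-1, g`_0; split; first by rewrite invr_eq0.
rewrite -horner_coef0 -horner_exp g_k horner_coef0 coefZ mul_mpolyC.
by rewrite /f dehom_line_through0.
Qed.

Theorem theorem6p1 (R : realType) (n r d : nat)
    (hn : (2 <= n)%N) (hr : (1 <= r)%N) (hd : (2 <= d)%N)
    (Gamma : {mpoly R[i][n]}) (hGamma : Gamma \is d.-homog) :
  clebsch_transfer r d Gamma = 0 <->
  exists G : {mpoly R[i][n]},
    G \is (gcdn r d).-homog /\ Gamma = G ^+ (d %/ gcdn r d)%N.
Proof.
have e_gt0 : (0 < gcdn r d)%N by rewrite gcdn_gt0 hr.
have d_gt0 := ltnW hd.
have k_gt0 : (0 < d %/ gcdn r d)%N by rewrite divn_gt0 // dvdn_leq // dvdn_gcdr.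
split=> [transfer0|[G [hom_G ->]]]; last first.
  rewrite /clebsch_transfer restrict_line_exp.
  apply: (@frakG_exp _ _ r d (gcdn r d) (r %/ gcdn r d)) => //.
  - by apply: mpoly_integral => x y /eqP; rewrite mulf_eq0.
  - exact: restrict_line_homog.
  by rewrite mulnC divnK // dvdn_gcdl.
(* The zero form has no point with nonzero value to draw lines through; it is a power of the zero
   form. *)
have [->|Gamma_neq0] := eqVneq Gamma 0.
  by exists 0; split; [apply: dhomog0 | rewrite expr0n gtn_eqF].
have char0 : [pchar R[i]] =i pred0 by apply: Num.Theory.pchar_num.
have [c [G [c_neq0 G_k]]] :=
  clebsch_transfer_root char0 hr hd hGamma Gamma_neq0 transfer0.
(* The constant [c] is absorbed into the root, the field being algebraically closed. *)
have [z z_k] : exists z : R[i], z ^+ (d %/ gcdn r d) = c^-1.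
  by eexists; apply: Num.Theory.rootCK.
have def_Gamma : Gamma = (z *: G) ^+ (d %/ gcdn r d).
  by rewrite exprZn z_k G_k scalerA mulVf // scale1r.
exists (z *: G); split=> //.
apply: (@dhomog_root _ _ _ _ (d %/ gcdn r d).-1) => //.
by rewrite prednK // -def_Gamma mulnC divnK // dvdn_gcdr.
Qed.
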